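(* Let $n\ge1$, let $\lambda=(\lambda_1,\dots,\lambda_n)$ be a partition of length at most $n$ with bottom partition $\lambda^{(0)}=(\lambda_2,\dots,\lambda_n)$, and let $0<a<b$. The Chebyshev-Bernstein basis $(B^n_{0,\lambda},\dots,B^n_{n,\lambda})$ of the Müntz space $\mathcal{E}_\lambda(n)$ over $[a,b]$ is given, for $k=0,\dots,n$ and $t>0$, by $$B^n_{k,\lambda}(t)=\frac{f_\lambda(n+1)}{f_{\lambda^{(0)}}(n)}\,B^n_k(t)\,\frac{S_{\lambda^{(0)}}(a^{n-k},b^k)\;t^{\lambda_1}\,S_\lambda\!\left(a^{n-k},b^k,\frac{ab}{t}\right)}{S_\lambda(a^{n+1-k},b^k)\,S_\lambda(a^{n-k},b^{k+1})},$$ where $B^n_k(t)=\binom nk\frac{(t-a)^k(b-t)^{n-k}}{(b-a)^n}$ is the classical Bernstein basis over $[a,b]$.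
   Context: Partitions and Schur functions: a partition of length at most $n$ is a sequence of integers $\lambda_1\ge\dots\ge\lambda_n\ge0$; partitions differing only by trailing zeros are identified. For a partition $\mu$ of length at most $m$, $S_\mu(u_1,\dots,u_m)=\det(u_i^{\mu_j+m-j})_{1\le i,j\le m}/\det(u_i^{m-j})_{1\le i,j\le m}$ is the Schur polynomial (evaluated also at coinciding arguments). The notation $S_\mu(x^p,y^q,\dots)$ means that the argument $x$ is repeated $p$ times, $y$ is repeated $q$ times, etc. $f_\mu(m)=S_\mu(1^m)$ is the number of semi-standard Young tableaux of shape $\mu$ with entries at most $m$; $f_\emptyset(m)=1$. Müntz space: $\mathcal{E}_\lambda(n)$ is the span on $]0,\infty[$ of $1,t^{\lambda_1-\lambda_2+1},t^{\lambda_1-\lambda_3+2},\dots,t^{\lambda_1-\lambda_n+(n-1)},t^{\lambda_1+n}$. Chebyshev-Bernstein basis of $\mathcal{E}_\lambda(n)$ over $[a,b]\subset\,]0,\infty[$: the unique basis $(B_0,\dots,B_n)$ of $\mathcal{E}_\lambda(n)$ with $\sum_{k}B_k=1$ such that, for each $k$, $B_k$ vanishes $k$ times at $a$ and $n-k$ times at $b$ (counting multiplicity). Equivalently, it is the family of functions with $\sum_kB_k=1$ and $\phi(t)=\sum_kB_k(t)\varphi(a^{n-k},b^k)$, where $\phi$ has as components the non-constant monomials above and $\varphi(a^{n-k},b^k)$ is the unique common point of the osculating flats of order $k$ of $\phi$ at $a$ and of order $n-k$ at $b$. *)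

(* Defs.v *)
From HB Require Import structures.
From mathcomp Require Import all_boot all_order all_algebra.
From mathcomp Require Import all_classical all_reals all_analysis.
(* Canonical structures only: the notations of mpoly clash with those of
   MathComp-Analysis. *)
From mathcomp Require Import (canonicals) mpoly.

Set Implicit Arguments.
Unset Strict Implicit.
Unset Printing Implicit Defensive.

Import Order.TTheory GRing.Theory Num.Theory.
Import numFieldNormedType.Exports.
Local Open Scope classical_set_scope.
Local Open Scope ring_scope.

(* Partitions are sequences mu of naturals; the part mu_(j+1) is nth 0 mu j, so
   that partitions differing only by trailing zeros have the same parts. *)
Definition is_partition (mu : seq nat) : bool := sorted geq mu.

(* det (X_i ^ (mu_j + m - j)) with 1 <= i, j <= m; the column index j is here
   0-based, whence the exponent m - j.+1. *)
Definition alternant (R : idomainType) (m : nat) (mu : seq nat) :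
    mpoly.mpoly m R :=
  \det (\matrix_(i < m, j < m)
     ((mpoly.mpolyX R (mpoly.mnm1 i) : mpoly.mpoly m R)
        ^+ (nth 0 mu j + (m - j.+1))%N)).

(* The quotient of two alternants in the integral domain R[X_1, ..., X_m]; the
   denominator is nonzero, so at most one polynomial satisfies the equation. *)
Definition schur_poly (R : idomainType) (m : nat) (mu : seq nat) :
    mpoly.mpoly m R :=
  xget 0 [set p : mpoly.mpoly m R | p * alternant R m [::] = alternant R m mu].

(* S_mu(u_1, ..., u_m), where m is the size of u; meaningful when mu has length
   at most m. *)
Definition schur (R : idomainType) (mu : seq nat) (u : seq R) : R :=
  mpoly.meval (fun i : 'I_(size u) => u`_i) (schur_poly R (size u) mu).

(* f_mu(m) = S_mu(1^m) *)
Definition schur1 (R : idomainType) (mu : seq nat) (m : nat) : R :=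
  schur mu (nseq m 1).

(* The exponents 0, l_1 - l_2 + 1, ..., l_1 - l_n + (n - 1), l_1 + n, for
   0 <= j <= n: the first and last ones are the cases j = 0 and j = n, with
   l_(n+1) = 0. The subtraction is exact when l is a partition. *)
Definition muntz_exponent (l : seq nat) (j : nat) : nat :=
  (nth 0 l 0 - nth 0 l j + j)%N.

(* Functions on ]0, +oo[ are represented by functions on R of which only the
   values at positive arguments matter. *)
Definition muntz_space (R : realType) (n : nat) (l : seq nat) : set (R -> R) :=
  [set f | exists c : {ffun 'I_n.+1 -> R},
     forall t, 0 < t -> f t = \sum_(j < n.+1) c j * t ^+ muntz_exponent l j].

Definition is_basis_on_pos (R : realType) (m : nat) (V : set (R -> R))
    (B : 'I_m -> R -> R) : Prop :=
  (forall k, V (B k)) /\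
  (forall f, V f -> exists! c : {ffun 'I_m -> R},
     forall t, 0 < t -> f t = \sum_(k < m) c k * B k t).

Definition vanishes_times (R : realType) (f : R -> R) (x : R) (k : nat) : Prop :=
  (forall j, (j < k)%N -> (f^`(j))%classic x = 0) /\ (f^`(k))%classic x <> 0.

Definition chebyshev_bernstein_basis (R : realType) (n : nat) (l : seq nat)
    (a b : R) (B : 'I_n.+1 -> R -> R) : Prop :=
  [/\ is_basis_on_pos (muntz_space n l) B,
      forall t, 0 < t -> \sum_(k < n.+1) B k t = 1 &
      forall k : 'I_n.+1,
        vanishes_times (B k) a k /\ vanishes_times (B k) b (n - k)].

Definition bernstein (R : realType) (n k : nat) (a b t : R) : R :=
  'C(n, k)%:R * ((t - a) ^+ k * (b - t) ^+ (n - k) / (b - a) ^+ n).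

(* Main.v *)
Require Import Defs.
From HB Require Import structures.
From mathcomp Require Import all_boot all_order all_algebra.
From mathcomp Require Import all_classical all_reals all_analysis.
From mathcomp Require Import fingroup perm zify ring.
From mathcomp Require Import (canonicals) mpoly.

(** Everything is carried by polynomials in [t], and rests on two facts.

    Schur polynomials. Subtracting from each column of [det (x_i ^ e_j)] a
    multiple of the next one, so as to clear the first row, and expanding by
    multilinearity, writes this determinant as the product of the
    [x_0 - x_i] and of a sum, with monomial coefficients, of determinants
    of the same kind in one variable less ([alternant_step], [det_sum_col]).
    Iterating gives an explicit sum [branching_sum], over Gelfand-Tsetlin
    patterns, which is the quotient of the alternant by the Vandermonde product
    in any commutative ring ([alternant_branching]). So Schur polynomials
    exist, they may be evaluated at coinciding arguments, they are positive at
    positive arguments ([schur_gt0]), and symmetric ([schur_perm]); expanding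
    the alternant along the row of one argument [x] shows that
    [S_mu (u, x) * prod_i (x - u_i)] only involves the powers
    [x ^ (mu_j + n + 1 - j)] ([schur_rcons_expand]).

    The Bernstein-like family. With [x = a b / t] and [u = (a^(n-k), b^k)] the
    last fact says that
      [P_k (t) = t ^ l_1 S_l (u, a b / t) (t - a) ^ k (b - t) ^ (n - k)]
    is in the Muntz space ([muntz_expansion]). By positivity its first factor
    does not vanish at [a] and [b], so [P_k] vanishes exactly [k] times at [a]
    and [n - k] times at [b]. The orders at [a] being distinct, the [P_k] are
    free, hence a basis of the Muntz space by dimension; comparing orders at
    [a] and at [b], an element of the space that vanishes at least [k] times at
    [a] and [n - k] times at [b] is a multiple of [P_k] ([bernstein_multiple]).

    It remains to find the [c_k] with [sum_k c_k P_k = 1]. The derivatives of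
    the elements of the Muntz space form, up to a power of [t], the Muntz space
    of the bottom partition, which has a family [R_k] of the same kind. Let [A]
    be the sum of the [c_i P_i] with [i <= k]. It vanishes [n - k] times at [b],
    and [1 - A] vanishes [k + 1] times at [a]; hence [A'] vanishes [n - k - 1]
    times at [b] and [k] times at [a], and is a multiple of [R_k]. Comparing
    leading coefficients at [b], where only [c_k P_k] contributes, and at [a],
    where only [c_(k+1) P_(k+1)] does, gives a recurrence between [c_k] and
    [c_(k+1)] ([unit_coef_recurrence]), which the coefficients of the theorem
    satisfy ([unit_coefP]). The first coefficient is given by evaluation at
    [a], where homogeneity of Schur polynomials turns [S (a, ..., a)] into the
    tableaux counts [f]. *)

Set Implicit Arguments.
Unset Strict Implicit.
Unset Printing Implicit Defensive.

Import Order.TTheory GRing.Theory Num.Theory.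
Import numFieldNormedType.Exports.
Local Open Scope classical_set_scope.
Local Open Scope ring_scope.

(** * Alternants and Gelfand-Tsetlin sums *)

(** Unfolding the recursion gives the sum over the Gelfand-Tsetlin patterns with
    top row [e], shifted so that the rows strictly decrease; for
    [e = (mu_j + m - j)_j] it is the Schur polynomial of [mu] in [x], with the
    first variable split off by the branching rule. *)
Fixpoint branching_sum (A : comNzRingType) (m : nat) :
    ('I_m -> nat) -> ('I_m -> A) -> A :=
  match m with
  | 0 => fun _ _ => 1
  | m'.+1 => fun e x =>
      \sum_(f : {ffun 'I_m' -> 'I_(e ord0)}
             | [forall j, e (lift ord0 j) <= f j < e (lift ord_max j)]%N)
        x ord0 ^+ (e ord_max + \sum_j (e (lift ord_max j) - (f j).+1))
        * branching_sum (fun j => f j : nat) (fun i => x (lift ord0 i))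
  end.

Fixpoint diff_prod (A : comNzRingType) (m : nat) : ('I_m -> A) -> A :=
  match m with
  | 0 => fun _ => 1
  | m'.+1 => fun x =>
      \prod_i (x ord0 - x (lift ord0 i)) * diff_prod (fun i => x (lift ord0 i))
  end.

Definition decreasing (m : nat) (e : 'I_m -> nat) :=
  forall i j : 'I_m, (i < j)%N -> (e j < e i)%N.

(** Multilinearity of the determinant in its columns. *)
Lemma det_sum_col (A : comNzRingType) (m N : nat) (Q : 'I_m -> pred 'I_N)
    (w : 'I_m -> 'I_N -> A) (F : 'I_m -> 'I_N -> A) :
  \det (\matrix_(i < m, j < m) \sum_(c | Q j c) w j c * F i c)
  = \sum_(f in family Q)
      \prod_j w j (f j) * \det (\matrix_(i < m, j < m) F i (f j)).
Proof.
have detE (M : 'M[A]_m) :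
    \det M = \sum_(s : 'S_m) (-1) ^+ s * \prod_j M (s j) j.
  by rewrite -det_tr; apply: eq_bigr => s _; under eq_bigr do rewrite mxE.
rewrite detE.
transitivity (\sum_(s : 'S_m) \sum_(f in family Q)
    (-1) ^+ s * \prod_j (w j (f j) * F (s j) (f j))).
  apply: eq_bigr => s _; under eq_bigr do rewrite mxE.
  by rewrite bigA_distr_big_dep big_distrr.
rewrite exchange_big /=; apply: eq_bigr => f _.
rewrite detE big_distrr /=; apply: eq_bigr => s _.
rewrite big_split /= mulrCA; congr (_ * (_ * _)).
by under [RHS]eq_bigr do rewrite mxE.
Qed.

Lemma sub_pow_sum (A : comNzRingType) (x y : A) (p q : nat) : (p <= q)%N ->
  x ^+ q - y ^+ (q - p) * x ^+ p
  = (x - y) * \sum_(p <= c < q) y ^+ (q - c.+1) * x ^+ c.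
Proof.
move=> le_pq; rewrite -{1}(subnK le_pq) exprD -mulrBl subrXX -mulrA.
congr (_ * _); rewrite big_distrl /= -[in RHS](add0n p) big_addn big_mkord.
rewrite (reindex_inj rev_ord_inj) /=; apply: eq_bigr => i _.
have lt_i := ltn_ord i.
rewrite mulrAC -exprD mulrC; congr (_ ^+ _ * _ ^+ _); lia.
Qed.

(** The branching rule before expansion. The column operations turn the first
    row into a single power of [x_0], and the entry of row [i] and column [j]
    into a difference [x_i ^ e_j - x_0 ^ (e_j - e_(j+1)) x_i ^ e_(j+1)], which
    [x_i - x_0] divides with a quotient that has coefficients [1]. *)
Lemma alternant_step (A : comNzRingType) (m : nat) (e : 'I_m.+1 -> nat)
    (x : 'I_m.+1 -> A) : decreasing e ->
  \det (\matrix_(i < m.+1, j < m.+1) x i ^+ e j)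
  = \prod_i (x ord0 - x (lift ord0 i)) * x ord0 ^+ e ord_max
    * \det (\matrix_(i < m, j < m)
        \sum_(e (lift ord0 j) <= c < e (lift ord_max j))
           x ord0 ^+ (e (lift ord_max j) - c.+1) * x (lift ord0 i) ^+ c).
Proof.
move=> e_decr.
set M := (X in \det X = _).
(* Right multiplication by [L] subtracts [x_0 ^ (e_j - e_(j+1))] times column
   [j + 1] from column [j]. *)
pose L : 'M[A]_m.+1 := \matrix_(l, j)
  ((l == j)%:R - (l == j.+1 :> nat)%:R * x ord0 ^+ (e j - e l)).
have detL : \det L = 1.
  rewrite det_trig; last first.
    apply/is_trig_mxP => i j lt_ij; rewrite mxE.
    by rewrite -val_eqE !ltn_eqF ?mul0r ?subr0 //; apply: leq_trans lt_ij _.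
  by rewrite big1 // => i _; rewrite mxE eqxx ltn_eqF // mul0r subr0.
have MLmax i : (M *m L) i ord_max = x i ^+ e ord_max.
  rewrite mxE (bigD1 ord_max) //= big1 => [|l ne_l].
    by rewrite !mxE eqxx ltn_eqF //= mul0r subr0 mulr1 addr0.
  by rewrite !mxE (negPf ne_l) ltn_eqF //= mul0r subr0 mulr0.
have MLlift i j : (M *m L) i (lift ord_max j) =
   (x i - x ord0) * \sum_(e (lift ord0 j) <= c < e (lift ord_max j))
           x ord0 ^+ (e (lift ord_max j) - c.+1) * x i ^+ c.
  have lt_e : (e (lift ord0 j) < e (lift ord_max j))%N.
    by apply: e_decr; rewrite lift_max lift0.
  rewrite -sub_pow_sum 1?ltnW // mxE.
  have ne_j : lift ord0 j != lift ord_max j.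
    by apply/eqP => /(congr1 (@nat_of_ord _)); rewrite lift_max lift0; lia.
  rewrite (bigD1 (lift ord_max j)) //= (bigD1 (lift ord0 j)) //= big1.
    rewrite !mxE eqxx (negPf ne_j) lift_max lift0 eqxx ltn_eqF //.
    by rewrite addr0 mul0r subr0 mulr1 mul1r sub0r mulrN mulrC.
  move=> l /andP[ne1 ne2]; rewrite !mxE (negPf ne1) lift_max.
  suff /negPf -> : l != j.+1 :> nat by rewrite mul0r subr0 mulr0.
  by apply: contra ne2 => /eqP e2; apply/eqP/ord_inj; rewrite lift0.
have -> : \det M = \det (M *m L) by rewrite det_mulmx detL mulr1.
rewrite (expand_det_row _ ord0).
rewrite (bigD1 ord_max) //= big1 => [|l]; last first.
  case: (unliftP ord_max l) => [j ->|-> /eqP//] _.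
  by rewrite MLlift subrr !mul0r.
rewrite MLmax addr0 /cofactor add0n.
pose d : 'rV[A]_m := \row_i (x (lift ord0 i) - x ord0).
set N := (X in _ = _ * \det X).
have -> : row' ord0 (col' ord_max (M *m L)) = diag_mx d *m N.
  apply/matrixP => i j; rewrite mul_diag_mx !mxE.
  by have := MLlift (lift ord0 i) j; rewrite mxE => ->.
rewrite det_mulmx det_diag !mulrA; congr (_ * _).
rewrite -mulrA mulrC; congr (_ * _).
rewrite -[X in (-1) ^+ X](card_ord m) -prodr_const -big_split /=.
by apply: eq_bigr => i _; rewrite mxE mulN1r opprB.
Qed.

(** The indices of the branching rule are again strictly decreasing exponents,
    which is what lets it be iterated. *)
Lemma decreasing_interlacing (m : nat) (e : 'I_m.+1 -> nat)
    (f : {ffun 'I_m -> 'I_(e ord0)}) : decreasing e ->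
  [forall j, e (lift ord0 j) <= f j < e (lift ord_max j)]%N ->
  decreasing (fun j => f j : nat).
Proof.
move=> e_decr /forallP fP i j lt_ij.
have /andP[_ lt1] := fP j; have /andP[le2 _] := fP i.
apply: leq_trans lt1 (leq_trans _ le2).
have [eq_ij|ne_ij] := eqVneq (lift ord_max j : nat) (lift ord0 i).
  by rewrite (ord_inj eq_ij).
by apply/ltnW/e_decr; rewrite ltn_neqAle eq_sym ne_ij lift_max lift0.
Qed.

(** The bialternant formula, without any division. *)
Lemma alternant_branching (A : comNzRingType) (m : nat) (e : 'I_m -> nat)
    (x : 'I_m -> A) : decreasing e ->
  \det (\matrix_(i < m, j < m) x i ^+ e j) = branching_sum e x * diff_prod x.
Proof.
elim: m => [|m IHm] in e x *; first by rewrite det_mx00 mulr1.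
move=> e_decr; rewrite alternant_step //=.
rewrite [RHS]mulrC -2!mulrA; congr (_ * _); rewrite [RHS]mulrC.
set x' := fun i => x (lift ord0 i).
pose Q (j : 'I_m) (c : 'I_(e ord0)) :=
  (e (lift ord0 j) <= c < e (lift ord_max j))%N.
pose w (j : 'I_m) (c : 'I_(e ord0)) := x ord0 ^+ (e (lift ord_max j) - c.+1).
rewrite [X in _ * \det X](_ : _ = \matrix_(i < m, j < m)
    \sum_(c | Q j c) w j c * x' i ^+ c); last first.
  apply/matrixP => i j; rewrite !mxE.
  have le_e : (e (lift ord_max j) <= e ord0)%N.
    have [->//|ne0] := eqVneq (lift ord_max j) ord0.
    by apply/ltnW/e_decr; rewrite lt0n.
  rewrite (big_nat_widenl _ 0) // (big_nat_widen _ _ _ _ _ le_e) big_mkord.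
  by apply: eq_bigl => c; rewrite /Q /= andbC.
rewrite (det_sum_col Q w (fun i c => x' i ^+ c)) big_distrr big_distrl /=.
apply: eq_big => [f|f /familyP Qf].
  by apply/familyP/forallP.
rewrite exprD -!mulrA -expr_sum; congr (_ * (_ * _)).
rewrite IHm //; apply: decreasing_interlacing e_decr _.
exact/forallP.
Qed.

Lemma branching_sum_rmorph (A B : comNzRingType) (g : {rmorphism A -> B})
    (m : nat) (e : 'I_m -> nat) (x : 'I_m -> A) :
  g (branching_sum e x) = branching_sum e (g \o x).
Proof.
elim: m => [|m IHm] in e x *; first by rewrite /= rmorph1.
rewrite /= rmorph_sum; apply: eq_bigr => f _.
by rewrite rmorphM rmorphXn IHm.
Qed.

Lemma eq_branching_sum (A : comNzRingType) (m : nat) (e e' : 'I_m -> nat)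
    (x x' : 'I_m -> A) : e =1 e' -> x =1 x' ->
  branching_sum e x = branching_sum e' x'.
Proof. by move=> /funext-> /funext->. Qed.

(** The staircase exponents are interlaced by one sequence only, the shorter
    staircase. This is how the alternant of the empty partition is recognized as
    the Vandermonde product. *)
Lemma branching_sum_staircase (A : comNzRingType) (m : nat) (e : 'I_m -> nat)
    (x : 'I_m -> A) : (forall j, e j = m - j.+1)%N -> branching_sum e x = 1.
Proof.
elim: m => [//|m IHm] in e x * => eE /=.
have lt_f (j : 'I_m) : (m - j.+1 < e ord0)%N.
  by rewrite eE /=; have := ltn_ord j; lia.
have f_of (f : {ffun 'I_m -> 'I_(e ord0)}) :
    [forall j, e (lift ord0 j) <= f j < e (lift ord_max j)]%N =
    (f == [ffun j => Ordinal (lt_f j)]).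
  apply/forallP/eqP => [f_int|-> j]; last first.
    rewrite ffunE (eE (lift ord0 j)) (eE (lift ord_max j)) lift0 lift_max /=.
    by rewrite !subSS leqnn ltn_sub2l // (ltn_ord j).
  apply/ffunP => j; rewrite ffunE; apply/ord_inj => /=.
  have := f_int j; rewrite (eE (lift ord0 j)) (eE (lift ord_max j)) lift0.
  rewrite lift_max !subSS.
  by rewrite -[(m - j)%N]prednK ?subn_gt0 // ltnS -subnS -eqn_leq => /eqP.
rewrite (eq_bigl _ _ f_of) big_pred1_eq /=.
rewrite IHm => [|j]; last by rewrite ffunE.
rewrite big1 => [|j _]; last
  by rewrite ffunE eE lift_max /=; have := ltn_ord j; lia.
by rewrite eE /= subnn addn0 expr0 mulr1.
Qed.

(** No sign occurs in the branching sum, so only its being nonempty is at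
    stake: the exponents [e_2, ..., e_m] interlace [e]. *)
Lemma branching_sum_gt0 (R : realDomainType) (m : nat) (e : 'I_m -> nat)
    (x : 'I_m -> R) : decreasing e -> (forall i, 0 < x i) ->
  0 < branching_sum e x.
Proof.
elim: m => [|m IHm] in e x *; first by rewrite ltr01.
move=> e_decr x_gt0 /=.
have lt_f (j : 'I_m) : (e (lift ord0 j) < e ord0)%N by apply: e_decr.
pose f0 : {ffun 'I_m -> 'I_(e ord0)} := [ffun j => Ordinal (lt_f j)].
have le_e (j : 'I_m) : (e (lift ord0 j) < e (lift ord_max j))%N.
  by apply: e_decr; rewrite lift_max lift0.
have f0P : [forall j, e (lift ord0 j) <= f0 j < e (lift ord_max j)]%N.
  by apply/forallP => j; rewrite ffunE /= leqnn le_e.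
have term_gt0 (f : {ffun 'I_m -> 'I_(e ord0)}) :
    [forall j, e (lift ord0 j) <= f j < e (lift ord_max j)]%N ->
    0 < x ord0 ^+ (e ord_max + \sum_j (e (lift ord_max j) - (f j).+1))
        * branching_sum (fun j => f j : nat) (fun i => x (lift ord0 i)).
  move=> fP; rewrite mulr_gt0 ?exprn_gt0 // IHm //.
  exact: decreasing_interlacing e_decr fP.
rewrite (bigD1 f0) //= ltr_pwDl ?term_gt0 // sumr_ge0 // => f /andP[fP _].
exact/ltW/term_gt0.
Qed.

(** The degree of [branching_sum e] is [sum_j e_j - m (m - 1) / 2]; the second
    term is moved to the left-hand side because it is subtracted. *)
Lemma branching_sum_homog (A : comNzRingType) (m : nat) (e : 'I_m -> nat)
    (c : A) (x : 'I_m -> A) : decreasing e ->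
  c ^+ 'C(m, 2) * branching_sum e (fun i => c * x i)
  = c ^+ (\sum_j e j) * branching_sum e x.
Proof.
elim: m => [|m IHm] in e x * => e_decr.
  by rewrite /= big_ord0 bin0n !expr0.
rewrite /= !big_distrr /=; apply: eq_bigr => f fP.
set s := (\sum_j _)%N.
have f_decr := decreasing_interlacing e_decr fP.
have -> : (\sum_j e j = m + \sum_j f j + (e ord_max + s))%N.
  rewrite big_ord_recr /= addnC addnCA; congr (_ + _)%N.
  have m_sum : m = (\sum_(j < m) 1)%N by rewrite sum1_card card_ord.
  rewrite [X in (_ = X + _ + _)%N]m_sum -!big_split /=.
  apply: eq_bigr => j _; have /andP[_] := forallP fP j.
  suff -> : widen_ord (leqnSn m) j = lift ord_max j by lia.
  by apply/ord_inj; rewrite lift_max.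
rewrite exprMn binS bin1 !exprD mulrCA.
have := IHm _ (fun i => x (lift ord0 i)) f_decr.
move: (branching_sum _ _) (branching_sum _ _) => p q eq_pq.
set K := c ^+ m * c ^+ e ord_max * c ^+ s * x ord0 ^+ e ord_max * x ord0 ^+ s.
transitivity (K * (c ^+ 'C(m, 2) * q)); first by rewrite /K; ring.
by rewrite eq_pq /K; ring.
Qed.

(** * Schur polynomials at arbitrary arguments *)
Lemma diff_prod_neq0 (A : idomainType) (m : nat) (x : 'I_m -> A) :
  injective x -> diff_prod x != 0.
Proof.
elim: m => [|m IHm] in x *; first by rewrite oner_eq0.
move=> x_inj /=; rewrite mulf_neq0 //.
  by apply/prodf_neq0 => i _; rewrite subr_eq0 (inj_eq x_inj).
by apply: IHm => i j /x_inj /lift_inj.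
Qed.

Lemma diff_prodE (A : comNzRingType) (m : nat) (x : 'I_m -> A) :
  diff_prod x = \det (\matrix_(i < m, j < m) x i ^+ (m - j.+1)).
Proof.
rewrite (alternant_branching (e := fun j : 'I_m => m - j.+1)%N) => [|i j lt_ij].
  by rewrite branching_sum_staircase ?mul1r.
by rewrite ltn_sub2l // (leq_trans _ (ltn_ord j)).
Qed.

(** The generic point. An identity in which the Vandermonde product can be
    cancelled is proved at these distinct indeterminates, and then evaluated at
    points that may coincide. *)
Definition indet (R : idomainType) (m : nat) (i : 'I_m) : mpoly.mpoly m R :=
  mpoly.mpolyX R (mpoly.mnm1 i).

Lemma indet_inj (R : idomainType) (m : nat) : injective (@indet R m).
Proof.
move=> i j /(congr1 (mpoly.mcoeff (mpoly.mnm1 i))) /eqP.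
rewrite !mpoly.mcoeffXU eqxx [j == i]eq_sym;
case: (i =P j) => //= _; by rewrite ?oner_eq0 // eq_sym oner_eq0.
Qed.

Lemma meval_indet (R : idomainType) (m : nat) (x : 'I_m -> R) :
  mpoly.meval x \o @indet R m = x.
Proof. by apply/funext => i; rewrite /= /indet mpoly.mevalXU. Qed.

Definition schur_exponent (mu : seq nat) (m : nat) (j : 'I_m) : nat :=
  (nth 0 mu j + (m - j.+1))%N.

Lemma partition_nth (mu : seq nat) (i j : nat) :
  is_partition mu -> (i <= j)%N -> (nth 0 mu j <= nth 0 mu i)%N.
Proof.
move=> mu_part le_ij; have [le_mu|lt_j] := leqP (size mu) j.
  by rewrite nth_default.
have geq_tr : transitive geq.
  by move=> y x z /= le_yx le_zy; apply: leq_trans le_zy le_yx.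
apply: (sorted_leq_nth geq_tr (@leqnn)) => //.
by rewrite inE (leq_ltn_trans le_ij).
Qed.

Lemma decreasing_schur_exponent (mu : seq nat) (m : nat) :
  is_partition mu -> decreasing (@schur_exponent mu m).
Proof.
move=> mu_part i j lt_ij; have := partition_nth mu_part (ltnW lt_ij).
by rewrite /schur_exponent; have := ltn_ord j; lia.
Qed.

(** The branching sum at the indeterminates solves the equation that defines
    [schur_poly], and the solution is unique since the alternant of the empty
    partition, a product of differences of distinct indeterminates, is
    cancellable. *)
Lemma schur_polyE (R : idomainType) (m : nat) (mu : seq nat) :
  is_partition mu ->
  schur_poly R m mu = branching_sum (@schur_exponent mu m) (@indet R m).
Proof.
move=> mu_part; rewrite /schur_poly.
have alt0 : alternant R m [::] = diff_prod (@indet R m).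
  rewrite diff_prodE; congr (\det _).
  by apply/matrixP => i j; rewrite !mxE nth_nil.
have altE : alternant R m mu =
    branching_sum (@schur_exponent mu m) (@indet R m) * diff_prod (@indet R m).
  by rewrite -alternant_branching //; apply: decreasing_schur_exponent.
apply: xget_unique => [|p /=]; first by rewrite /= alt0 altE.
rewrite alt0 altE => /mulIf; apply.
exact/diff_prod_neq0/indet_inj.
Qed.

Lemma schurE (R : idomainType) (mu : seq nat) (u : seq R) :
  is_partition mu ->
  schur mu u =
  branching_sum (@schur_exponent mu (size u)) (fun i : 'I_(size u) => u`_i).
Proof.
move=> mu_part; rewrite /schur schur_polyE // branching_sum_rmorph.
by rewrite meval_indet.
Qed.

Lemma branching_sum_indet (R : idomainType) (m : nat) (e : 'I_m -> nat)
    (x : 'I_m -> R) (s : 'I_m -> 'I_m) :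
  branching_sum e (x \o s) =
  mpoly.meval x (branching_sum e (@indet R m \o s)).
Proof.
rewrite branching_sum_rmorph; apply: eq_branching_sum => // i.
by rewrite /= /indet mpoly.mevalXU.
Qed.

(** At the generic point, a permutation of the variables multiplies both
    alternants by its signature, and their quotient is unchanged. *)
Lemma branching_sum_perm (R : idomainType) (m : nat) (e : 'I_m -> nat)
    (x : 'I_m -> R) (s : 'S_m) :
  decreasing e -> branching_sum e (x \o s) = branching_sum e x.
Proof.
move=> e_decr; rewrite branching_sum_indet (branching_sum_indet e x id).
congr (mpoly.meval _ _); set y := @indet R m.
have alt_perm (f : 'I_m -> nat) :
    \det (\matrix_(i < m, j < m) (y \o s) i ^+ f j)
    = (-1) ^+ s * \det (\matrix_(i < m, j < m) y i ^+ f j).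
  rewrite -det_perm -det_mulmx -row_permE; congr (\det _).
  by apply/matrixP => i j; rewrite !mxE.
have diff_prod_perm : diff_prod (y \o s) = (-1) ^+ s * diff_prod y.
  by rewrite !diff_prodE alt_perm.
have := alt_perm e; rewrite !alternant_branching // diff_prod_perm mulrCA.
move/(can_inj (signrMK s))/mulIf; apply.
exact/diff_prod_neq0/indet_inj.
Qed.

(** Laplace expansion of the alternant along its first row: every minor is an
    alternant in the other variables, so their Vandermonde product cancels. *)
Lemma branching_sum_expand (R : idomainType) (m : nat) (e : 'I_m.+1 -> nat)
    (x : 'I_m.+1 -> R) : decreasing e ->
  branching_sum e x * \prod_i (x ord0 - x (lift ord0 i))
  = \sum_(j < m.+1) (-1) ^+ j
      * branching_sum (fun i => e (lift j i)) (fun i => x (lift ord0 i))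
      * x ord0 ^+ e j.
Proof.
move=> e_decr; pose y := @indet R m.+1.
have minor_decr j : decreasing (fun i => e (lift j i)).
  by move=> i1 i2 lt_i; apply: e_decr; rewrite /= ltnNge leq_bump2 -ltnNge.
have diff_neq0 : diff_prod (fun i => y (lift ord0 i)) != 0.
  by apply: diff_prod_neq0 => i j /indet_inj /lift_inj.
have generic : branching_sum e y * \prod_i (y ord0 - y (lift ord0 i))
  = \sum_(j < m.+1) (-1) ^+ j
      * branching_sum (fun i => e (lift j i)) (fun i => y (lift ord0 i))
      * y ord0 ^+ e j.
  apply: (mulIf diff_neq0).
  rewrite -mulrA -/(diff_prod y) -alternant_branching //.
  rewrite (expand_det_row _ ord0).
  rewrite big_distrl /=; apply: eq_bigr => j _.
  rewrite mxE /cofactor add0n mulrC -!mulrA [_ * diff_prod _]mulrC !mulrA.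
  congr (_ * _); rewrite -mulrA -alternant_branching //; congr (_ * \det _).
  by apply/matrixP => i k; rewrite !mxE.
have evalE f : mpoly.meval x (branching_sum f (fun i => y (lift ord0 i)))
    = branching_sum f (fun i => x (lift ord0 i)).
  rewrite branching_sum_rmorph; apply: eq_branching_sum => // i.
  by rewrite /= /y /indet mpoly.mevalXU.
move/(congr1 (mpoly.meval x)): generic.
rewrite rmorphM branching_sum_rmorph meval_indet rmorph_prod [in RHS]rmorph_sum.
under eq_bigr do rewrite rmorphB /y /indet /= !mpoly.mevalXU.
move=> ->; apply: eq_bigr => j _.
rewrite 2!rmorphM rmorph_sign rmorphXn; congr (_ * _ * _ ^+ _).
  exact: evalE.
exact: mpoly.mevalXU.
Qed.

Lemma schurE_size (R : idomainType) (mu : seq nat) (u : seq R) (m : nat) :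
  is_partition mu -> size u = m ->
  schur mu u =
  branching_sum (@schur_exponent mu m) (fun i : 'I_m => u`_i).
Proof. by move=> mu_part <-; apply: schurE. Qed.

Lemma schur_perm (R : idomainType) (mu : seq nat) (u v : seq R) :
  is_partition mu -> perm_eq u v -> schur mu u = schur mu v.
Proof.
move=> mu_part uv; have size_uv := perm_size uv.
rewrite (schurE_size mu_part size_uv) schurE //.
have /tuple_permP[s u_eq] : perm_eq u (in_tuple v) by [].
rewrite -(branching_sum_perm _ s (decreasing_schur_exponent mu_part)).
apply: eq_branching_sum => // i /=.
by rewrite u_eq -tnth_nth tnth_mktuple (tnth_nth 0).
Qed.

Lemma schur_rmorph (R S : idomainType) (g : {rmorphism R -> S}) (mu : seq nat)
    (u : seq R) : is_partition mu -> g (schur mu u) = schur mu (map g u).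
Proof.
move=> mu_part; rewrite (@schurE_size _ _ _ (size u)) //.
rewrite (@schurE_size S _ _ (size u)) ?size_map // branching_sum_rmorph.
by apply: eq_branching_sum => // i /=; rewrite (nth_map 0).
Qed.

Lemma schur_gt0 (R : realDomainType) (mu : seq nat) (u : seq R) :
  is_partition mu -> {in u, forall y, 0 < y} -> 0 < schur mu u.
Proof.
move=> mu_part u_gt0; rewrite schurE //.
apply: branching_sum_gt0 (decreasing_schur_exponent mu_part) _ => i.
exact/u_gt0/mem_nth.
Qed.

(** Homogeneity, at equal arguments. *)
Lemma schur_nseq (R : idomainType) (mu : seq nat) (m : nat) (c : R) :
  is_partition mu ->
  c ^+ 'C(m, 2) * schur mu (nseq m c)
  = c ^+ (\sum_(j < m) schur_exponent mu j) * schur1 R mu m.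
Proof.
move=> mu_part; rewrite /schur1 !(@schurE_size _ _ _ m) ?size_nseq //.
rewrite -branching_sum_homog; last exact: decreasing_schur_exponent.
congr (_ * _); apply: eq_branching_sum => // i.
by rewrite !nth_nseq ltn_ord mulr1.
Qed.

Definition schur_coef (R : idomainType) (mu : seq nat) (m : nat) (u : seq R)
    (j : 'I_m.+1) : R :=
  (-1) ^+ j * branching_sum (fun i => schur_exponent mu (lift j i))
                (fun i : 'I_m => u`_i).

(** As a function of its last argument, and up to a product of linear factors, a
    Schur polynomial is a combination of the powers occurring in the
    corresponding row of its alternant. This is where the exponents of the Muntz
    space come from. *)
Lemma schur_rcons_expand (R : idomainType) (mu : seq nat) (m : nat) (u : seq R)
    (x : R) : is_partition mu -> size u = m ->
  schur mu (rcons u x) * \prod_(y <- u) (x - y)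
  = \sum_(j < m.+1) schur_coef mu u j * x ^+ schur_exponent mu j.
Proof.
move=> mu_part <-.
rewrite (schur_perm mu_part (_ : perm_eq _ (x :: u))) ?perm_rcons //.
rewrite schurE // (big_nth 0) big_mkord.
exact: (branching_sum_expand _ (decreasing_schur_exponent mu_part)).
Qed.

Lemma schur_coef_rmorph (R S : idomainType) (g : {rmorphism R -> S})
    (mu : seq nat) (m : nat) (u : seq R) (j : 'I_m.+1) : size u = m ->
  schur_coef mu (map g u) j = g (schur_coef mu u j).
Proof.
move=> size_u; rewrite rmorphM rmorph_sign branching_sum_rmorph.
congr (_ * _); apply: eq_branching_sum => // i.
by rewrite /= (nth_map 0) // size_u.
Qed.

(** * The Bernstein-like elements of a Muntz space *)
Lemma poly_eq_pos (R : numFieldType) (p q : {poly R}) :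
  (forall t, 0 < t -> p.[t] = q.[t]) -> p = q.
Proof.
move=> eq_pq; apply/eqP; rewrite -subr_eq0; apply/negPn/negP => pq_neq0.
pose s := [seq i.+1%:R : R | i <- iota 0 (size (p - q))].
have s_uniq : uniq s.
  rewrite map_inj_uniq ?iota_uniq // => i j /eqP.
  by rewrite eqr_nat eqSS => /eqP.
have /(max_poly_roots pq_neq0)/(_ s_uniq) : all (root (p - q)) s.
  apply/allP => _ /mapP[i _ ->].
  by rewrite /root hornerD hornerN eq_pq ?subrr // ltr0n.
by rewrite size_map size_iota ltnn.
Qed.

(** The Schur polynomial as a univariate polynomial in its last argument. *)
Definition schur_last (R : idomainType) (mu : seq nat) (u : seq R) : {poly R} :=
  schur mu (rcons (map polyC u) 'X).

Lemma horner_schur_last (R : idomainType) (mu : seq nat) (u : seq R) (x : R) :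
  is_partition mu -> (schur_last mu u).[x] = schur mu (rcons u x).
Proof.
move=> mu_part; rewrite -/(horner_eval x _) schur_rmorph // map_rcons -map_comp.
congr (schur _ (rcons _ _)); last by rewrite /= /horner_eval hornerX.
by rewrite -[RHS]map_id; apply: eq_map => y; rewrite /= /horner_eval hornerC.
Qed.

(** After multiplication by [prod_i (X - u_i)], of degree [size u], the
    expansion of the alternant has degree at most [mu_1 + size u]. *)
Lemma size_schur_last (R : idomainType) (mu : seq nat) (u : seq R) :
  is_partition mu -> (size (schur_last mu u) <= (nth 0 mu 0).+1)%N.
Proof.
move=> mu_part.
have [->|q_neq0] := eqVneq (schur_last mu u) 0; first by rewrite size_poly0.
have size_map_u : size (map polyC u) = size u by rewrite size_map.
rewrite -(leq_add2r (size u)).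
have -> : (size (schur_last mu u) + size u =
    (size (schur_last mu u * \prod_(y <- u) ('X - y%:P))%R))%N.
  by rewrite size_Mmonic ?monic_prod_XsubC // size_prod_XsubC addnS.
rewrite -(big_map polyC predT (fun y => 'X - y)).
rewrite (schur_rcons_expand _ mu_part size_map_u).
apply: leq_trans (size_sum _ _ _) _; apply/bigmax_leqP => j _.
rewrite (schur_coef_rmorph polyC) // mul_polyC.
apply: leq_trans (size_scale_leq _ _) _; rewrite size_polyXn addSn ltnS.
rewrite /schur_exponent leq_add ?partition_nth //.
by rewrite leq_subLR addSn ltnS leq_addl.
Qed.

(** The polynomial in [t] equal to [t ^ mu_1 S_mu (u, c / t)], obtained by
    reading backwards the coefficients of [schur_last mu u]. *)
Definition schur_reversed (R : fieldType) (mu : seq nat) (u : seq R) (c : R) :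
    {poly R} :=
  let d := nth 0 mu 0 in
  \poly_(i < d.+1) ((schur_last mu u)`_(d - i) * c ^+ (d - i)).

Lemma horner_schur_reversed (R : fieldType) (mu : seq nat) (u : seq R)
    (c t : R) : is_partition mu -> t != 0 ->
  (schur_reversed mu u c).[t] = t ^+ nth 0 mu 0 * schur mu (rcons u (c / t)).
Proof.
move=> mu_part t_neq0; rewrite horner_poly -horner_schur_last //.
rewrite (horner_coef_wide _ (size_schur_last u mu_part)) big_distrr /=.
rewrite (reindex_inj rev_ord_inj) /=; apply: eq_bigr => i _.
have le_i : (i <= nth 0 mu 0)%N by rewrite -ltnS.
rewrite subSS subKn // exprMn exprVn -[X in t ^+ X * _](subnK le_i) exprD.
by field; rewrite expf_neq0.
Qed.

Definition bernstein_product (R : idomainType) (n : nat) (a b : R) (k : nat) :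
    {poly R} :=
  ('X - a%:P) ^+ k * (b%:P - 'X) ^+ (n - k).

Definition nodes (R : Type) (n : nat) (a b : R) (k : nat) : seq R :=
  nseq (n - k) a ++ nseq k b.

Lemma size_nodes (R : Type) (n : nat) (a b : R) (k : nat) : (k <= n)%N ->
  size (nodes n a b k) = n.
Proof. by move=> le_kn; rewrite size_cat !size_nseq subnK. Qed.

(** In the expansion of [schur_rcons_expand] at [x = a b / t], the factors
    [x - a] and [x - b] become [a (b - t) / t] and [- b (t - a) / t], and
    [t ^ (mu_1 + n) x ^ (mu_j + n + 1 - j)] is, up to a constant, the power of
    [t] with the Muntz exponent. *)
Lemma muntz_expansion (R : realFieldType) (mu : seq nat) (n k : nat) (a b : R) :
  is_partition mu -> 0 < a -> 0 < b -> (k <= n)%N ->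
  exists g : 'I_n.+1 -> R,
    schur_reversed mu (nodes n a b k) (a * b) * bernstein_product n a b k
    = \sum_j g j *: 'X^(muntz_exponent mu j).
Proof.
move=> mu_part a_gt0 b_gt0 le_kn; set u := nodes n a b k.
have size_u : size u = n by apply: size_nodes.
(* The constant relating [prod_i (a b / t - u_i)] to the Bernstein product,
   inverted; note that [(-1) ^ k] is its own inverse. *)
pose K := (-1) ^+ k / (a ^+ (n - k) * b ^+ k).
exists (fun j => K * schur_coef mu u j * (a * b) ^+ schur_exponent mu j).
apply: poly_eq_pos => t t_gt0.
have [a_neq0 b_neq0 t_neq0] : [/\ a != 0, b != 0 & t != 0] by rewrite !gt_eqF.
rewrite hornerM horner_schur_reversed // horner_sum.
have := schur_rcons_expand (a * b / t) mu_part size_u.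
set S := schur _ _.
have -> : \prod_(y <- u) (a * b / t - y)
    = (-1) ^+ k * a ^+ (n - k) * b ^+ k
      * (bernstein_product n a b k).[t] / t ^+ n.
  rewrite big_cat !big_nseq !iter_mulr_1 /bernstein_product !hornerE /=.
  have -> : a * b / t - a = a * (b - t) / t by field.
  have -> : a * b / t - b = -1 * (b * (t - a) / t) by field.
  rewrite !exprMn !exprVn -[in t ^+ n](subnK le_kn) exprD.
  by field; rewrite !expf_neq0.
set P := _.[t] => S_eq.
have sgn2 : (-1) ^+ k * (-1) ^+ k = 1 :> R by rewrite -expr2 sqrr_sign.
have -> : t ^+ nth 0 mu 0 * S * P = t ^+ (nth 0 mu 0 + n) * K
    * (S * ((-1) ^+ k * a ^+ (n - k) * b ^+ k * P / t ^+ n)).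
  rewrite /K exprD -[LHS]mul1r -[X in X * _ = _]sgn2.
  by field; rewrite !expf_neq0.
rewrite S_eq big_distrr /=; apply: eq_bigr => j _.
have le_mu : (nth 0 mu j <= nth 0 mu 0)%N by apply: partition_nth.
have -> : (nth 0 mu 0 + n = muntz_exponent mu j + schur_exponent mu j)%N.
  by rewrite /muntz_exponent /schur_exponent; have := ltn_ord j; lia.
rewrite hornerZ hornerXn exprD !exprMn exprVn.
by field; rewrite expf_neq0.
Qed.

(** * Families with prescribed orders of vanishing at two points *)

(** Both end points are treated at once: [l] is [X - a] with [z = a] or [b - X]
    with [z = b]. *)
Lemma leading_term (R : idomainType) (I : finType) (l : {poly R}) (z : R)
    (d : I -> nat) (H : I -> {poly R}) (c : I -> R) (i0 : I) :
  root l z -> (forall i, i != i0 -> c i != 0 -> (d i0 < d i)%N) ->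
  exists2 W, \sum_i c i *: (l ^+ d i * H i) = l ^+ d i0 * W
    & W.[z] = c i0 * (H i0).[z].
Proof.
move=> /rootP lz d_gt.
exists (c i0 *: H i0 + \sum_(i | i != i0) c i *: (l ^+ (d i - d i0) * H i)).
  rewrite (bigD1 i0) //= mulrDr scalerAr; congr (_ + _).
  rewrite big_distrr; apply: eq_bigr => i ne_i /=.
  have [->|c_neq0] := eqVneq (c i) 0; first by rewrite !scale0r mulr0.
  by rewrite -scalerAr mulrA -exprD subnKC // ltnW // d_gt.
rewrite hornerD hornerZ horner_sum big1 ?addr0 // => i ne_i.
have [->|c_neq0] := eqVneq (c i) 0; first by rewrite scale0r horner0.
rewrite hornerZ hornerM horner_exp lz expr0n subn_eq0 leqNgt d_gt //.
by rewrite mul0r mulr0.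
Qed.

(** The terms have pairwise distinct orders of vanishing at [z], so no
    cancellation is possible: by induction on the order, every term of order
    less than [r] must vanish. *)
Lemma vanishing_coef (R : idomainType) (I : finType) (l : {poly R}) (z : R)
    (d : I -> nat) (H : I -> {poly R}) (c : I -> R) (r : nat) (q : {poly R}) :
  l != 0 -> root l z -> injective d -> (forall i, (H i).[z] != 0) ->
  \sum_i c i *: (l ^+ d i * H i) = l ^+ r * q ->
  forall i, (d i < r)%N -> c i = 0.
Proof.
move=> l_neq0 lz d_inj Hz_neq0 sum_eq i; have [m] := ubnP (d i).
elim: m => // m IHm in i * => le_i lt_ir; apply/eqP/negPn/negP => ci_neq0.
have d_gt j : j != i -> c j != 0 -> (d i < d j)%N.
  move=> ne_ji cj_neq0.
  rewrite ltnNge leq_eqVlt (inj_eq d_inj) (negPf ne_ji) /=.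
  apply: contra cj_neq0 => lt_ji; apply/eqP/IHm; last exact: ltn_trans lt_ir.
  exact: leq_trans lt_ji _.
have [W sum_eqW Wz] := leading_term H lz d_gt.
have : W = l ^+ (r - d i) * q.
  apply: (mulfI (expf_neq0 (d i) l_neq0)).
  by rewrite -sum_eqW sum_eq mulrA -exprD subnKC // ltnW.
move/(congr1 (horner^~ z)) => /eqP; rewrite Wz hornerM horner_exp (rootP lz).
rewrite expr0n subn_eq0 leqNgt lt_ir mul0r mulf_eq0 (negPf ci_neq0).
by rewrite (negPf (Hz_neq0 i)).
Qed.

(** A free family is a basis of a space spanned by equally many vectors; the
    vectors [Q j] need not be free for this. *)
Lemma span_of_free (F : fieldType) (V : lmodType F) (N : nat) (P Q : 'I_N -> V)
    (C : 'M[F]_N) :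
  (forall k, P k = \sum_j C k j *: Q j) ->
  (forall c : 'I_N -> F, \sum_k c k *: P k = 0 -> forall k, c k = 0) ->
  forall j, Q j = \sum_k invmx C j k *: P k.
Proof.
move=> P_eq P_free j.
have sumE (v : 'rV_N) : \sum_k v 0 k *: P k = \sum_j (v *m C) 0 j *: Q j.
  under eq_bigr do rewrite P_eq scaler_sumr.
  rewrite exchange_big; apply: eq_bigr => i _; rewrite mxE scaler_suml.
  by apply: eq_bigr => k _; rewrite scalerA.
have C_unit : C \in unitmx.
  rewrite -row_free_unit -kermx_eq0; apply/rowV0P => v /sub_kermxP vC0.
  apply/rowP => k; rewrite mxE; apply: P_free (v 0) _ k.
  by rewrite sumE vC0 big1 // => i _; rewrite mxE scale0r.
transitivity (\sum_k row j (invmx C) 0 k *: P k); last first.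
  by apply: eq_bigr => k _; rewrite mxE.
rewrite sumE -row_mul mulVmx // (bigD1 j) //= big1 => [|i ne_ij].
  by rewrite !mxE eqxx scale1r addr0.
by rewrite !mxE eq_sym (negPf ne_ij) scale0r.
Qed.

Lemma left_factor (R : idomainType) (n : nat) (a b : R)
    (G : 'I_n.+1 -> {poly R}) (c : 'I_n.+1 -> R) :
  \sum_k c k *: (G k * bernstein_product n a b k)
  = \sum_k c k *: (('X - a%:P) ^+ k * (G k * (b%:P - 'X) ^+ (n - k))).
Proof. by apply: eq_bigr => k _; rewrite /bernstein_product mulrCA. Qed.

Lemma right_factor (R : idomainType) (n : nat) (a b : R)
    (G : 'I_n.+1 -> {poly R}) (c : 'I_n.+1 -> R) :
  \sum_k c k *: (G k * bernstein_product n a b k)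
  = \sum_k c k *: ((b%:P - 'X) ^+ (n - k) * (G k * ('X - a%:P) ^+ k)).
Proof.
by apply: eq_bigr => k _; rewrite [(b%:P - _) ^+ _ * _]mulrC -mulrA.
Qed.

Lemma root_subX (R : idomainType) (b : R) : root (b%:P - 'X) b.
Proof. by rewrite /root !hornerE subrr. Qed.

Lemma subX_neq0 (R : idomainType) (b : R) : b%:P - 'X != 0 :> {poly R}.
Proof. by rewrite -opprB oppr_eq0 polyXsubC_eq0. Qed.

Lemma vanishing_left (R : idomainType) (n : nat) (a b : R)
    (G : 'I_n.+1 -> {poly R}) (c : 'I_n.+1 -> R) (r : nat) (q : {poly R}) :
  a != b -> (forall k, (G k).[a] != 0) ->
  \sum_k c k *: (G k * bernstein_product n a b k) = ('X - a%:P) ^+ r * q ->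
  forall k : 'I_n.+1, (k < r)%N -> c k = 0.
Proof.
move=> ne_ab Ga; rewrite left_factor.
apply: (vanishing_coef (z := a)); rewrite ?polyXsubC_eq0 ?root_XsubC //.
  exact: ord_inj.
move=> k; rewrite hornerM horner_exp !hornerE.
by rewrite mulf_neq0 ?Ga // expf_neq0 // subr_eq0 eq_sym.
Qed.

Lemma vanishing_right (R : idomainType) (n : nat) (a b : R)
    (G : 'I_n.+1 -> {poly R}) (c : 'I_n.+1 -> R) (r : nat) (q : {poly R}) :
  a != b -> (forall k, (G k).[b] != 0) ->
  \sum_k c k *: (G k * bernstein_product n a b k) = (b%:P - 'X) ^+ r * q ->
  forall k : 'I_n.+1, (n - k < r)%N -> c k = 0.
Proof.
move=> ne_ab Gb; rewrite right_factor.
apply: (vanishing_coef (subX_neq0 b) (root_subX b)).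
  move=> i j eq_ij; apply/ord_inj.
  by have := ltn_ord i; have := ltn_ord j; move: eq_ij; lia.
move=> k; rewrite hornerM horner_exp !hornerE.
by rewrite mulf_neq0 ?Gb // expf_neq0 // subr_eq0 eq_sym.
Qed.

(** Vanishing at [a] excludes the terms before the [i]-th one, and vanishing at
    [b] those after it. *)
Lemma bernstein_multiple (R : idomainType) (n : nat) (a b : R)
    (G : 'I_n.+1 -> {poly R}) (c : 'I_n.+1 -> R) (i : 'I_n.+1) (q q' : {poly R}) :
  a != b -> (forall k, (G k).[a] != 0) -> (forall k, (G k).[b] != 0) ->
  let f := \sum_k c k *: (G k * bernstein_product n a b k) in
  f = ('X - a%:P) ^+ i * q -> f = (b%:P - 'X) ^+ (n - i) * q' ->
  f = c i *: (G i * bernstein_product n a b i).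
Proof.
move=> ne_ab Ga Gb f eql eqr.
rewrite /f (bigD1 i) //= big1 ?addr0 // => k ne_ki.
have [lt_ki|le_ik] := ltnP k i.
  by rewrite (vanishing_left ne_ab Ga eql lt_ki) scale0r.
have lt_ik : (i < k)%N by rewrite ltn_neqAle le_ik eq_sym ne_ki.
have le_kn : (k <= n)%N by rewrite -ltnS.
rewrite (vanishing_right ne_ab Gb eqr) ?scale0r // ltn_sub2l //.
exact: leq_trans lt_ik le_kn.
Qed.

(** The sum of the first [k + 1] terms of the decomposition of [1] has, up to
    sign, the same derivative as the sum of the remaining ones. The former is
    small at [b] and the latter at [a], which leaves only a multiple of
    [H k * bernstein_product n a b k]; its leading coefficient at [b] comes from
    the [k]-th term of the decomposition and the one at [a] from the next term.
    *)
Lemma unit_coef_recurrence (R : idomainType) (n : nat) (a b : R)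
    (G : 'I_n.+2 -> {poly R}) (H : 'I_n.+1 -> {poly R}) (c : 'I_n.+2 -> R) :
  a != b ->
  (forall k, (H k).[a] != 0) -> (forall k, (H k).[b] != 0) ->
  (forall k, exists d : 'I_n.+1 -> R,
     (G k * bernstein_product n.+1 a b k)^`()
     = \sum_i d i *: (H i * bernstein_product n a b i)) ->
  \sum_k c k *: (G k * bernstein_product n.+1 a b k) = 1 ->
  forall k : 'I_n.+1,
    (n.+1 - k)%:R * c (lift ord_max k) * (G (lift ord_max k)).[b] * (H k).[a]
    = k.+1%:R * c (lift ord0 k) * (G (lift ord0 k)).[a] * (H k).[b].
Proof.
move=> ne_ab Ha Hb dG sum1 k.
have ab_neq0 : b - a != 0 by rewrite subr_eq0 eq_sym.
set kl := lift ord_max k; set kr := lift ord0 k.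
have klE : kl = k :> nat by rewrite lift_max.
have krE : kr = k.+1 :> nat by [].
pose cl (i : 'I_n.+2) := if (i <= k)%N then c i else 0.
pose cr (i : 'I_n.+2) := if (i <= k)%N then 0 else c i.
pose A := \sum_i cl i *: (G i * bernstein_product n.+1 a b i).
pose A' := \sum_i cr i *: (G i * bernstein_product n.+1 a b i).
have AD : A + A' = 1.
  rewrite -sum1 -big_split; apply: eq_bigr => i _ /=.
  by rewrite /cl /cr; case: leqP => _; rewrite scale0r ?addr0 ?add0r.
have dA' : A'^`() = - A^`().
  by apply/eqP; rewrite -addr_eq0 -derivD addrC AD derivC.
(* [A] vanishes at least [n + 1 - k] times at [b], [A'] at least [k + 1] at [a];
   [W] and [Z] are the cofactors. *)
have [W A_eq Wb] : exists2 W, A = (b%:P - 'X) ^+ (n.+1 - k) * W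
    & W.[b] = c kl * ((G kl).[b] * (b - a) ^+ k).
  rewrite /A right_factor -[in (n.+1 - k)%N]klE.
  have [i ne_i|W W_eq Wb] := @leading_term R _ (b%:P - 'X) b
    (fun i : 'I_n.+2 => n.+1 - i)%N (fun i => G i * ('X - a%:P) ^+ i) cl kl
    (root_subX b).
    rewrite /cl; case: (leqP i k) => [le_ik _|_ /eqP//].
    have lt_ik : (i < kl)%N by rewrite ltn_neqAle ne_i klE.
    by rewrite ltn_sub2l //; move: lt_ik; rewrite klE; have := ltn_ord k; lia.
  exists W => //; rewrite Wb /cl klE leqnn; congr (_ * _).
  by rewrite hornerM horner_exp !hornerE.
have [Z A'_eq Za] : exists2 Z, A' = ('X - a%:P) ^+ k.+1 * Z
    & Z.[a] = c kr * ((G kr).[a] * (b - a) ^+ (n - k)).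
  rewrite /A' left_factor -krE.
  have [|i ne_i|Z Z_eq Za] := @leading_term R _ ('X - a%:P) a
    (fun i : 'I_n.+2 => i : nat)
    (fun i => G i * (b%:P - 'X) ^+ (n.+1 - i)) cr kr.
  - by rewrite root_XsubC.
  - rewrite /cr; case: (leqP i k) => [_ /eqP//|lt_ki _].
    by rewrite ltn_neqAle eq_sym ne_i krE.
  exists Z => //; rewrite Za /cr krE ltnn; congr (_ * _).
  by rewrite hornerM horner_exp !hornerE.
have [d dA] : exists d : 'I_n.+1 -> R,
    A^`() = \sum_i d i *: (H i * bernstein_product n a b i).
  have [D DE] := choice dG.
  exists (fun i => \sum_j cl j * D j i); rewrite /A linear_sum /=.
  under eq_bigr => j _ do rewrite linearZ /= DE scaler_sumr.
  rewrite exchange_big; apply: eq_bigr => i _ /=; rewrite scaler_suml.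
  by apply: eq_bigr => j _; rewrite scalerA.
have nk : (n.+1 - k = (n - k).+1)%N by rewrite subSn // -ltnS.
have dA_right : A^`() = (b%:P - 'X) ^+ (n - k)
    * ((b%:P - 'X) * W^`() - (n - k).+1%:R * W).
  rewrite A_eq nk derivM deriv_exp derivB derivC derivX sub0r /=.
  by rewrite exprS -mulr_natl; ring.
have dA_left : - A^`() = ('X - a%:P) ^+ k
    * (('X - a%:P) * Z^`() + k.+1%:R * Z).
  rewrite -dA' A'_eq derivM deriv_exp derivB derivC derivX subr0 /=.
  by rewrite exprS -mulr_natl; ring.
have dA_k : A^`() = d k *: (H k * bernstein_product n a b k).
  rewrite dA; apply: (bernstein_multiple ne_ab Ha Hb); rewrite -dA.
    by rewrite -[LHS]opprK dA_left -mulrN.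
  exact: dA_right.
(* Both expressions of the derivative are divided by the power of the linear
   factor that vanishes at the end point, and then evaluated there. *)
have at_b : d k * ((H k).[b] * (b - a) ^+ k)
    = - ((n - k).+1%:R * W.[b]).
  have /(mulfI (expf_neq0 (n - k) (subX_neq0 b))) : (b%:P - 'X) ^+ (n - k)
      * ((b%:P - 'X) * W^`() - (n - k).+1%:R * W)
    = (b%:P - 'X) ^+ (n - k) * (d k *: (H k * ('X - a%:P) ^+ k)).
    by rewrite -dA_right dA_k /bernstein_product -!mul_polyC; ring.
  move/(congr1 (horner^~ b)); rewrite !hornerE /= subrr mul0r add0r.
  by rewrite hornerMn hornerC => <-.
have at_a : - (d k * ((H k).[a] * (b - a) ^+ (n - k))) = k.+1%:R * Z.[a].
  have /(mulfI (expf_neq0 k (negbT (polyXsubC_eq0 a)))) : ('X - a%:P) ^+ k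
      * (('X - a%:P) * Z^`() + k.+1%:R * Z)
    = ('X - a%:P) ^+ k * (- (d k *: (H k * (b%:P - 'X) ^+ (n - k)))).
    by rewrite -dA_left dA_k /bernstein_product -!mul_polyC; ring.
  move/(congr1 (horner^~ a)); rewrite !hornerE /= subrr mul0r add0r.
  by rewrite hornerMn hornerC => <-.
apply: (mulIf (mulf_neq0 (expf_neq0 k ab_neq0) (expf_neq0 (n - k) ab_neq0))).
rewrite Wb in at_b; rewrite Za in at_a; rewrite nk.
transitivity (- (H k).[a] * (b - a) ^+ (n - k)
    * - ((n - k).+1%:R * (c kl * ((G kl).[b] * (b - a) ^+ k)))); first by ring.
transitivity ((H k).[b] * (b - a) ^+ k
    * (k.+1%:R * (c kr * ((G kr).[a] * (b - a) ^+ (n - k))))); last by ring.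
by rewrite -at_b -at_a; ring.
Qed.

(** * The Bernstein-like basis of a Muntz space *)
Lemma schur1_gt0 (R : realFieldType) (mu : seq nat) (n : nat) :
  is_partition mu -> 0 < schur1 R mu n.
Proof. by move=> mu_part; apply: schur_gt0 => // y /nseqP[->]. Qed.

Lemma schur_nodes_gt0 (R : realFieldType) (mu : seq nat) (a b : R) (p q : nat) :
  is_partition mu -> 0 < a -> 0 < b -> 0 < schur mu (nseq p a ++ nseq q b).
Proof.
move=> mu_part a_gt0 b_gt0; apply: schur_gt0 => // y.
by rewrite mem_cat !mem_nseq => /orP[] /andP[_ /eqP->].
Qed.

(** At [t = a] the last argument [a b / t] is [b], and at [t = b] it is [a]: the
    values at the end points are Schur polynomials at the neighbouring nodes. *)
Lemma schur_reversed_left (R : fieldType) (mu : seq nat) (n k : nat) (a b : R) :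
  is_partition mu -> a != 0 ->
  (schur_reversed mu (nodes n a b k) (a * b)).[a]
  = a ^+ nth 0 mu 0 * schur mu (nseq (n - k) a ++ nseq k.+1 b).
Proof.
move=> mu_part a_neq0; rewrite horner_schur_reversed // rcons_cat.
rewrite mulrAC mulfV // mul1r; congr (_ * schur _ (_ ++ _)).
by elim: k => //= k ->.
Qed.

Lemma schur_reversed_right (R : fieldType) (mu : seq nat) (n k : nat)
    (a b : R) : is_partition mu -> b != 0 ->
  (schur_reversed mu (nodes n a b k) (a * b)).[b]
  = b ^+ nth 0 mu 0 * schur mu (nseq (n - k).+1 a ++ nseq k b).
Proof.
move=> mu_part b_neq0; rewrite horner_schur_reversed // mulfK //.
by congr (_ * _); apply: schur_perm => //; rewrite perm_rcons.
Qed.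

Lemma schur_reversed_neq0 (R : realFieldType) (mu : seq nat) (n : nat)
    (a b : R) : is_partition mu -> 0 < a -> 0 < b ->
  (forall k, (schur_reversed mu (nodes n a b k) (a * b)).[a] != 0) /\
  (forall k, (schur_reversed mu (nodes n a b k) (a * b)).[b] != 0).
Proof.
move=> mu_part a_gt0 b_gt0; split=> k.
  by rewrite schur_reversed_left ?gt_eqF // mulr_gt0 ?exprn_gt0
    ?schur_nodes_gt0.
by rewrite schur_reversed_right ?gt_eqF // mulr_gt0 ?exprn_gt0
    ?schur_nodes_gt0.
Qed.

Definition muntz_bernstein (R : fieldType) (mu : seq nat) (n : nat) (a b : R)
    (k : nat) : {poly R} :=
  schur_reversed mu (nodes n a b k) (a * b) * bernstein_product n a b k.

Lemma muntz_bernstein_free (R : realFieldType) (mu : seq nat) (n : nat)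
    (a b : R) (c : 'I_n.+1 -> R) : is_partition mu -> 0 < a -> a < b ->
  \sum_k c k *: muntz_bernstein mu n a b k = 0 -> forall k, c k = 0.
Proof.
move=> mu_part a_gt0 lt_ab; have b_gt0 := lt_trans a_gt0 lt_ab.
have [Ga Gb] := schur_reversed_neq0 n mu_part a_gt0 b_gt0.
have ne_ab : a != b by rewrite lt_eqF.
move=> sum0 k.
apply: (vanishing_left (r := n.+1) (q := 0) ne_ab (fun i => Ga i)).
  by rewrite mulr0.
exact: ltn_ord.
Qed.

Lemma muntz_bernstein_expansion (R : realFieldType) (mu : seq nat) (n : nat)
    (a b : R) : is_partition mu -> 0 < a -> a < b ->
  exists C : 'M[R]_n.+1, forall k : 'I_n.+1,
    muntz_bernstein mu n a b k = \sum_j C k j *: 'X^(muntz_exponent mu j).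
Proof.
move=> mu_part a_gt0 lt_ab; have b_gt0 := lt_trans a_gt0 lt_ab.
have expansion (k : 'I_n.+1) : exists g : 'I_n.+1 -> R,
    muntz_bernstein mu n a b k = \sum_j g j *: 'X^(muntz_exponent mu j).
  by apply: muntz_expansion; rewrite // -ltnS.
have [g gE] := choice expansion.
exists (\matrix_(k, j) g k j) => k.
by rewrite gE; apply: eq_bigr => j _; rewrite mxE.
Qed.

(** Dimension count: the family is free because of its orders of vanishing at
    [a], and it has as many members as the Muntz space has generators. *)
Lemma muntz_bernstein_span (R : realFieldType) (mu : seq nat) (n : nat)
    (a b : R) : is_partition mu -> 0 < a -> a < b ->
  exists D : 'M[R]_n.+1, forall j : 'I_n.+1,
    'X^(muntz_exponent mu j) = \sum_k D j k *: muntz_bernstein mu n a b k.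
Proof.
move=> mu_part a_gt0 lt_ab.
have [C CE] := muntz_bernstein_expansion n mu_part a_gt0 lt_ab.
exists (invmx C) => j; apply: (span_of_free CE) => c.
exact: muntz_bernstein_free.
Qed.

(** The cofactor of the Bernstein product in the family attached to derivatives.
    The exponents [m_j - 1] of the derivatives are the Muntz exponents of the
    bottom partition shifted by [mu_1 - mu_2]. *)
Definition shifted_reversed (R : fieldType) (mu : seq nat) (n : nat) (a b : R)
    (k : nat) : {poly R} :=
  'X^(nth 0 mu 0 - nth 0 mu 1)
  * schur_reversed (behead mu) (nodes n a b k) (a * b).

Lemma is_partition_behead (mu : seq nat) :
  is_partition mu -> is_partition (behead mu).
Proof. by case: mu => // x mu /path_sorted. Qed.

Lemma shifted_reversed_left (R : fieldType) (mu : seq nat) (n k : nat)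
    (a b : R) : is_partition mu -> a != 0 ->
  (shifted_reversed mu n a b k).[a]
  = a ^+ nth 0 mu 0 * schur (behead mu) (nseq (n - k) a ++ nseq k.+1 b).
Proof.
move=> mu_part a_neq0; rewrite hornerM hornerXn schur_reversed_left //.
  by rewrite nth_behead mulrA -exprD subnK // partition_nth.
exact: is_partition_behead.
Qed.

Lemma shifted_reversed_right (R : fieldType) (mu : seq nat) (n k : nat)
    (a b : R) : is_partition mu -> b != 0 ->
  (shifted_reversed mu n a b k).[b]
  = b ^+ nth 0 mu 0 * schur (behead mu) (nseq (n - k).+1 a ++ nseq k b).
Proof.
move=> mu_part b_neq0; rewrite hornerM hornerXn schur_reversed_right //.
  by rewrite nth_behead mulrA -exprD subnK // partition_nth.
exact: is_partition_behead.
Qed.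

Lemma deriv_muntz_bernstein (R : realFieldType) (mu : seq nat) (n : nat)
    (a b : R) (k : 'I_n.+2) : is_partition mu -> 0 < a -> a < b ->
  exists d : 'I_n.+1 -> R,
    (muntz_bernstein mu n.+1 a b k)^`()
    = \sum_i d i *: (shifted_reversed mu n a b i * bernstein_product n a b i).
Proof.
move=> mu_part a_gt0 lt_ab.
have [D DE] := muntz_bernstein_span n (is_partition_behead mu_part) a_gt0 lt_ab.
have [C ->] := muntz_bernstein_expansion n.+1 mu_part a_gt0 lt_ab.
exists (fun i => \sum_j C k (lift ord0 j)
                 * (muntz_exponent mu j.+1)%:R * D j i).
rewrite big_ord_recl linearD /= linear_sum linearZ /= derivXn.
rewrite [muntz_exponent mu 0]/muntz_exponent subnn mulr0n scaler0 add0r.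
under [RHS]eq_bigr do rewrite scaler_suml.
rewrite exchange_big; apply: eq_bigr => j _ /=.
rewrite linearZ /= derivXn /bump leq0n add1n.
have -> : ((muntz_exponent mu j.+1).-1
    = nth 0 mu 0 - nth 0 mu 1 + muntz_exponent (behead mu) j)%N.
  rewrite /muntz_exponent !nth_behead addnS /=.
  have := partition_nth mu_part (leq0n 1).
  by have := partition_nth mu_part (_ : 1 <= j.+1)%N; lia.
rewrite exprD DE big_distrr -scaler_nat scaler_sumr scaler_sumr.
apply: eq_bigr => i _ /=; rewrite -scalerAr !scalerA /shifted_reversed.
by rewrite /muntz_bernstein mulrA.
Qed.

(** * The decomposition of the constant function *)
Definition unit_coef (R : realFieldType) (mu : seq nat) (n : nat) (a b : R)
    (k : nat) : R :=
  schur1 R mu n.+1 / schur1 R (behead mu) n * ('C(n, k)%:R / (b - a) ^+ n)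
  * (schur (behead mu) (nodes n a b k)
     / (schur mu (nseq (n.+1 - k) a ++ nseq k b)
        * schur mu (nseq (n - k) a ++ nseq k.+1 b))).

(** Both sides are the product of the two tableaux counts and of [a] to the sum
    of the first [n + 1] parts of [mu]; this fixes the normalization constant of
    the theorem. *)
Lemma schur_nseq_behead (R : fieldType) (mu : seq nat) (n : nat) (a : R) :
  is_partition mu -> a != 0 ->
  a ^+ nth 0 mu 0 * (schur1 R mu n.+1 * schur (behead mu) (nseq n a))
  = schur1 R (behead mu) n * schur mu (nseq n.+1 a).
Proof.
move=> mu_part a_neq0.
have mu'_part := is_partition_behead mu_part.
apply: (mulfI (expf_neq0 'C(n.+1, 2) a_neq0)).
rewrite [RHS]mulrCA schur_nseq // big_ord_recl.
transitivity (a ^+ (nth 0 mu 0 + n) * schur1 R mu n.+1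
    * (a ^+ 'C(n, 2) * schur (behead mu) (nseq n a))).
  by rewrite binS bin1 !exprD; ring.
rewrite schur_nseq // [schur_exponent mu ord0]/schur_exponent subSS subn0.
under [in RHS]eq_bigr => j _.
  rewrite (_ : schur_exponent _ _ = schur_exponent (behead mu) j); last first.
    by rewrite /schur_exponent nth_behead lift0 subSS.
  over.
by rewrite !exprD; ring.
Qed.

(** This equation and the next one are the field computations behind the
    formula for the coefficients, isolated so that they take place among plain
    variables. *)
Lemma first_coef_eq (F : fieldType) (c A D f f' s0 s1 s2 : F) :
  A != 0 -> D != 0 -> f' != 0 -> s0 != 0 -> s1 != 0 -> s2 != 0 ->
  A * (f * s0) = f' * s2 -> c * A * s1 * D = 1 ->
  c = f / f' * (1 / D) * (s0 / (s2 * s1)).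
Proof.
move=> A0 D0 f'0 s00 s10 s20 f_eq c_eq.
have -> : f = f' * s2 / (A * s0) by rewrite -f_eq; field; rewrite A0 s00.
have -> : c = (A * s1 * D)^-1.
  apply: (mulIf (_ : A * s1 * D != 0)); first by rewrite !mulf_neq0.
  by rewrite mulVf ?mulf_neq0 // -c_eq !mulrA.
by field; rewrite A0 D0 f'0 s00 s10 s20.
Qed.

Lemma next_coef_eq (F : fieldType) (c K D A B p p' q q' u v t m m' : F) :
  A != 0 -> B != 0 -> D != 0 -> u != 0 -> v != 0 -> t != 0 -> q != 0 ->
  m' != 0 -> m' * p' = m * p ->
  m * (K * (p / D) * (q / (u * v))) * (B * u) * (A * q')
  = m' * c * (A * t) * (B * q) ->
  c = K * (p' / D) * (q' / (v * t)).
Proof.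
move=> A0 B0 D0 u0 v0 t0 q0 m'0 p_eq c_eq.
have -> : p' = m * p / m' by rewrite -p_eq; field.
apply: (mulfI (_ : m' * A * t * B * q != 0)); first by rewrite !mulf_neq0.
transitivity (m' * c * (A * t) * (B * q)); first by ring.
rewrite -c_eq; field.
by rewrite D0 u0 v0 t0 m'0.
Qed.

(** Evaluation at [a], where all terms but the first vanish, gives the first
    coefficient; the recurrence gives the others, thanks to
    [(k + 1) C(n, k + 1) = (n - k) C(n, k)]. *)
Lemma unit_coefP (R : realFieldType) (mu : seq nat) (n : nat) (a b : R)
    (c : 'I_n.+2 -> R) : is_partition mu -> 0 < a -> a < b ->
  \sum_k c k *: muntz_bernstein mu n.+1 a b k = 1 ->
  forall k : 'I_n.+2, c k = unit_coef mu n.+1 a b k.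
Proof.
move=> mu_part a_gt0 lt_ab sum1; have b_gt0 := lt_trans a_gt0 lt_ab.
have mu'_part := is_partition_behead mu_part.
have ne_ab : a != b by rewrite lt_eqF.
have [a_neq0 b_neq0] : a != 0 /\ b != 0 by rewrite !gt_eqF.
have ba_neq0 : b - a != 0 by rewrite subr_eq0 eq_sym.
(* The values of Schur polynomials are abstracted: unification must not unfold
   them. *)
have [s sE] : exists s, forall p q, schur mu (nseq p a ++ nseq q b) = s p q.
  by exists (fun p q => schur mu (nseq p a ++ nseq q b)).
have [s' s'E] : exists s',
    forall p q, schur (behead mu) (nseq p a ++ nseq q b) = s' p q.
  by exists (fun p q => schur (behead mu) (nseq p a ++ nseq q b)).
have s_neq0 p q : s p q != 0 by rewrite -sE gt_eqF // schur_nodes_gt0.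
have s'_neq0 p q : s' p q != 0 by rewrite -s'E gt_eqF // schur_nodes_gt0.
have f_neq0 : schur1 R (behead mu) n.+1 != 0 by rewrite gt_eqF // schur1_gt0.
suff c_eq k (lt_k : (k < n.+2)%N) : c (Ordinal lt_k) = unit_coef mu n.+1 a b k.
  by case.
elim: k lt_k => [|k IHk] lt_k.
  have := congr1 (horner^~ a) sum1.
  rewrite horner_sum big_ord_recl big1 => [|i _]; last first.
    rewrite hornerZ !hornerM horner_exp hornerXsubC subrr expr0n lift0.
    by rewrite mul0r !mulr0.
  rewrite /= hornerZ hornerM schur_reversed_left // /bernstein_product.
  rewrite expr0 mul1r subn0 horner_exp !hornerE sE.
  have -> : ord0 = Ordinal lt_k by apply/ord_inj.
  have aL_neq0 : a ^+ nth 0 mu 0 != 0 by rewrite expf_neq0.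
  have : a ^+ nth 0 mu 0 * (schur1 R mu n.+2 * s' n.+1 0)
      = schur1 R (behead mu) n.+1 * s n.+2 0.
    by rewrite -sE -s'E !cats0 schur_nseq_behead.
  rewrite /unit_coef /nodes !subn0 bin0 !sE s'E => f_eq c_eq.
  exact: (first_coef_eq aL_neq0 (expf_neq0 _ ba_neq0) f_neq0 (s'_neq0 _ _)
    (s_neq0 _ _) (s_neq0 _ _) f_eq c_eq).
have lt_k1 : (k < n.+1)%N by [].
have lt_k2 : (k < n.+2)%N by apply: ltnW.
have Ha i : (shifted_reversed mu n a b i).[a] != 0.
  by rewrite shifted_reversed_left // s'E mulf_neq0 // expf_neq0.
have Hb i : (shifted_reversed mu n a b i).[b] != 0.
  by rewrite shifted_reversed_right // s'E mulf_neq0 // expf_neq0.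
have := unit_coef_recurrence ne_ab (fun i => Ha i) (fun i => Hb i)
  (fun i => deriv_muntz_bernstein i mu_part a_gt0 lt_ab) sum1 (Ordinal lt_k1).
have -> : lift ord_max (Ordinal lt_k1) = Ordinal lt_k2.
  by apply/ord_inj; rewrite lift_max.
have -> : lift ord0 (Ordinal lt_k1) = Ordinal lt_k by apply/ord_inj.
rewrite IHk /= shifted_reversed_left // shifted_reversed_right //.
rewrite schur_reversed_left // schur_reversed_right //.
have kn : (n.+1 - k = (n - k).+1)%N by rewrite subSn.
rewrite /unit_coef /nodes !subSS -kn [(n.+2 - k)%N]subSn 1?ltnW // !sE !s'E.
apply: next_coef_eq; rewrite ?s_neq0 ?s'_neq0 ?expf_neq0 ?pnatr_eq0 //.
by rewrite -!natrM mul_bin_left.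
Qed.

Lemma unit_coef_neq0 (R : realFieldType) (mu : seq nat) (n : nat) (a b : R)
    (k : 'I_n.+1) : is_partition mu -> 0 < a -> a < b ->
  unit_coef mu n a b k != 0.
Proof.
move=> mu_part a_gt0 lt_ab; have b_gt0 := lt_trans a_gt0 lt_ab.
have mu'_part := is_partition_behead mu_part.
have le_kn : (k <= n)%N by rewrite -ltnS.
rewrite gt_eqF // /unit_coef /nodes; apply: mulr_gt0; last first.
  by rewrite divr_gt0 ?mulr_gt0 ?schur_nodes_gt0.
rewrite mulr_gt0 ?divr_gt0 ?schur1_gt0 ?exprn_gt0 ?subr_gt0 //.
by rewrite ltr0n bin_gt0.
Qed.

Lemma horner_muntz_bernstein (R : realFieldType) (mu : seq nat) (n : nat)
    (a b t : R) (k : nat) : is_partition mu -> 0 < t ->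
  unit_coef mu n a b k * (muntz_bernstein mu n a b k).[t]
  = schur1 R mu n.+1 / schur1 R (behead mu) n * (
      'C(n, k)%:R * ((t - a) ^+ k * (b - t) ^+ (n - k) / (b - a) ^+ n))
    * (schur (behead mu) (nseq (n - k) a ++ nseq k b)
        * t ^+ nth 0%N mu 0
        * schur mu (nseq (n - k) a ++ nseq k b ++ [:: a * b / t])
        / (schur mu (nseq (n.+1 - k) a ++ nseq k b)
           * schur mu (nseq (n - k) a ++ nseq k.+1 b))).
Proof.
move=> mu_part t_gt0.
have bpE : (bernstein_product n a b k).[t] = (t - a) ^+ k * (b - t) ^+ (n - k).
  by rewrite hornerM !horner_exp !hornerE.
rewrite hornerM horner_schur_reversed ?gt_eqF // bpE /unit_coef /nodes.
rewrite -cats1 -catA.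
move: (schur mu (_ ++ _ ++ _)) (schur (behead mu) _) (_ * schur mu _)^-1.
move: (schur1 _ _ _ / _) => f x y z.
by ring.
Qed.

(** * Orders of vanishing and the Chebyshev-Bernstein basis *)
Lemma horner_derivn_mul_XsubC (R : idomainType) (x : R) (k j : nat)
    (q : {poly R}) : (j <= k)%N ->
  ((('X - x%:P) ^+ k * q)^`(j)).[x] = if j == k then k`!%:R * q.[x] else 0.
Proof.
elim: j k q => [|j IHj] [|k] q // le_jk.
- by rewrite derivn0 eqxx expr0 fact0 !mul1r.
- by rewrite derivn0 exprS !hornerE subrr !mul0r.
rewrite derivSn derivM deriv_exp derivB derivC derivX subr0 mul1r /=.
rewrite exprSr.
rewrite [X in X + _](_ : _ = ('X - x%:P) ^+ k * (k.+1%:R * q)); last first.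
  by rewrite -mulr_natl; ring.
rewrite -mulrA -mulrDr IHj // eqSS; case: eqP => // _.
by rewrite !hornerE subrr mul0r addr0 hornerMn hornerC factS natrM; ring.
Qed.

Lemma dvd_XsubC_derivn (R : realDomainType) (x : R) (k : nat) (p : {poly R}) :
  (forall j, (j < k)%N -> (p^`(j)).[x] = 0) ->
  exists q, p = ('X - x%:P) ^+ k * q.
Proof.
elim: k => [|k IHk] p_van; first by exists p; rewrite expr0 mul1r.
have [j lt_jk|q p_eq] := IHk; first exact/p_van/ltnW.
have /eqP := p_van k (leqnn _).
rewrite p_eq horner_derivn_mul_XsubC // eqxx mulf_eq0 pnatr_eq0.
rewrite eqn0Ngt fact_gt0 /= => /factor_theorem[q' q_eq].
by exists q'; rewrite q_eq exprSr -mulrA [q' * _]mulrC.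
Qed.

(** Only positive arguments matter, but they form a neighbourhood of every point
    at which a derivative is taken. *)
Lemma derive1n_eq_horner (R : realType) (f : R -> R) (p : {poly R}) :
  (forall t, 0 < t -> f t = p.[t]) ->
  forall (j : nat) (x : R), 0 < x -> (f^`(j))%classic x = (p^`(j))%R.[x].
Proof.
move=> fp; elim=> [|j IHj] x x_gt0; first by rewrite derive1n0 fp.
rewrite derive1nS derivnS derivE !derive1E; apply: near_eq_derive.
by near=> y; apply: IHj; near: y; exact: lt_nbhsr.
Unshelve. all: by end_near. Qed.

Lemma muntz_space_horner (R : realType) (mu : seq nat) (n : nat) (a b : R)
    (c : 'I_n.+1 -> R) (f : R -> R) : is_partition mu -> 0 < a -> a < b ->
  (forall t, 0 < t -> f t = (\sum_k c k *: muntz_bernstein mu n a b k).[t]) ->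
  muntz_space n mu f.
Proof.
move=> mu_part a_gt0 lt_ab f_eq.
have [C CE] := muntz_bernstein_expansion n mu_part a_gt0 lt_ab.
exists [ffun j => \sum_k c k * C k j] => t t_gt0; rewrite f_eq // horner_sum.
under eq_bigr => k _ do rewrite hornerZ CE horner_sum big_distrr /=.
rewrite exchange_big; apply: eq_bigr => j _; rewrite ffunE big_distrl /=.
by apply: eq_bigr => k _; rewrite hornerZ hornerXn mulrA.
Qed.

Lemma muntz_space_coef (R : realType) (mu : seq nat) (n : nat) (a b : R)
    (f : R -> R) : is_partition mu -> 0 < a -> a < b ->
  muntz_space n mu f ->
  exists c : 'I_n.+1 -> R, forall t, 0 < t ->
    f t = (\sum_k c k *: muntz_bernstein mu n a b k).[t].
Proof.
move=> mu_part a_gt0 lt_ab [g f_eq].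
have [D DE] := muntz_bernstein_span n mu_part a_gt0 lt_ab.
exists (fun k => \sum_j g j * D j k) => t t_gt0; rewrite f_eq //.
transitivity (\sum_(j < n.+1) g j *: 'X^(muntz_exponent mu j)).[t].
  by rewrite horner_sum; apply: eq_bigr => j _; rewrite hornerZ hornerXn.
congr (_.[_]); under eq_bigr do rewrite DE scaler_sumr.
rewrite exchange_big; apply: eq_bigr => k _ /=; rewrite scaler_suml.
by apply: eq_bigr => j _; rewrite scalerA.
Qed.

Lemma muntz_bernstein_vanishes (R : realType) (mu : seq nat) (n : nat) (a b : R)
    (k : 'I_n.+1) (c : R) (f : R -> R) : is_partition mu -> 0 < a -> a < b ->
  c != 0 -> (forall t, 0 < t -> f t = c * (muntz_bernstein mu n a b k).[t]) ->
  vanishes_times f a k /\ vanishes_times f b (n - k).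
Proof.
move=> mu_part a_gt0 lt_ab c_neq0 f_eq; have b_gt0 := lt_trans a_gt0 lt_ab.
have [Ga Gb] := schur_reversed_neq0 n mu_part a_gt0 b_gt0.
have ba_neq0 : b - a != 0 by rewrite subr_eq0 gt_eqF.
have vanishes (z : R) (m : nat) (q : {poly R}) : 0 < z -> q.[z] != 0 ->
    c *: muntz_bernstein mu n a b k = ('X - z%:P) ^+ m * q ->
    vanishes_times f z m.
  move=> z_gt0 qz pE.
  have fp t : 0 < t -> f t = (('X - z%:P) ^+ m * q).[t].
    by move=> t_gt0; rewrite -pE hornerZ f_eq.
  split=> [j lt_jm|]; rewrite (derive1n_eq_horner fp) //.
    by rewrite horner_derivn_mul_XsubC ?ltn_eqF // ltnW.
  rewrite horner_derivn_mul_XsubC // eqxx; apply/eqP.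
  by rewrite mulf_neq0 // pnatr_eq0 -lt0n fact_gt0.
split.
  apply: (vanishes _ _ (c *: (schur_reversed mu (nodes n a b k) (a * b)
                              * (b%:P - 'X) ^+ (n - k)))) => //.
    by rewrite hornerZ hornerM horner_exp !hornerE !mulf_neq0 ?expf_neq0.
  by rewrite -scalerAr mulrCA.
apply: (vanishes _ _ (((-1) ^+ (n - k) * c)
    *: (schur_reversed mu (nodes n a b k) (a * b) * ('X - a%:P) ^+ k))) => //.
  by rewrite hornerZ hornerM horner_exp hornerXsubC !mulf_neq0 ?signr_eq0
    ?expf_neq0.
rewrite /muntz_bernstein /bernstein_product -[b%:P - 'X]opprB.
rewrite [(- ('X - _)) ^+ _]exprNn.
by rewrite -!mul_polyC polyCM polyC_exp polyCN; ring.
Qed.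

(** The vanishing conditions force [B k] to be a multiple of the [k]-th element
    of the family, and the partition of unity then determines the factors.
    Conversely the formula gives a basis since its factors are nonzero. *)
Lemma chebyshev_bernstein_iff (R : realType) (mu : seq nat) (n : nat)
    (a b : R) (B : 'I_n.+2 -> R -> R) : is_partition mu -> 0 < a -> a < b ->
  chebyshev_bernstein_basis mu a b B <->
  (forall (k : 'I_n.+2) (t : R), 0 < t ->
     B k t = unit_coef mu n.+1 a b k * (muntz_bernstein mu n.+1 a b k).[t]).
Proof.
move=> mu_part a_gt0 lt_ab; have b_gt0 := lt_trans a_gt0 lt_ab.
have ne_ab : a != b by rewrite lt_eqF.
have [Ga Gb] := schur_reversed_neq0 n.+1 mu_part a_gt0 b_gt0.
pose P (k : 'I_n.+2) := muntz_bernstein mu n.+1 a b k.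
split=> [[[B_in _] B_sum B_van] k t t_gt0|B_eq].
  have B_line i : exists c, forall t, 0 < t -> B i t = (c *: P i).[t].
    have [c cE] := muntz_space_coef mu_part a_gt0 lt_ab (B_in i).
    have [[B_a _] [B_b _]] := B_van i.
    exists (c i) => u u_gt0; rewrite cE //; congr (_.[_]).
    have [q qE] : exists q, \sum_k c k *: P k = ('X - a%:P) ^+ i * q.
      apply: dvd_XsubC_derivn => j lt_j.
      by rewrite -(derive1n_eq_horner cE) // B_a.
    have [q' q'E] : exists q, \sum_k c k *: P k = ('X - b%:P) ^+ (n.+1 - i) * q.
      apply: dvd_XsubC_derivn => j lt_j.
      by rewrite -(derive1n_eq_horner cE) // B_b.
    apply: (bernstein_multiple ne_ab (fun k => Ga k) (fun k => Gb k) qE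
      (q' := (-1) ^+ (n.+1 - i) * q')).
    by rewrite q'E -opprB [(- (b%:P - _)) ^+ _]exprNn -mulrA mulrCA.
  have [c cE] := choice B_line.
  have sum1 : \sum_k c k *: P k = 1.
    apply: poly_eq_pos => u u_gt0; rewrite hornerC -(B_sum u u_gt0) horner_sum.
    by apply: eq_bigr => i _; rewrite cE.
  by rewrite cE // hornerZ (unit_coefP mu_part a_gt0 lt_ab sum1).
have uc_neq0 (k : 'I_n.+2) := unit_coef_neq0 k mu_part a_gt0 lt_ab.
have lin (c : 'I_n.+2 -> R) t : 0 < t ->
    \sum_k c k * B k t = (\sum_k (c k * unit_coef mu n.+1 a b k) *: P k).[t].
  move=> t_gt0; rewrite horner_sum; apply: eq_bigr => k _.
  by rewrite hornerZ B_eq // mulrA.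
split; last by move=> k; apply: muntz_bernstein_vanishes (uc_neq0 k) (B_eq k).
- split=> [k|f f_in].
    apply: (muntz_space_horner
      (c := fun i => (i == k)%:R * unit_coef mu n.+1 a b k)
      mu_part a_gt0 lt_ab) => t t_gt0.
    rewrite (bigD1 k) //= big1 => [|i /negPf->]; last by rewrite mul0r scale0r.
    by rewrite eqxx mul1r addr0 hornerZ B_eq.
  have [c cE] := muntz_space_coef mu_part a_gt0 lt_ab f_in.
  exists [ffun k => c k / unit_coef mu n.+1 a b k]; split=> [t t_gt0|c' c'E].
    rewrite lin // cE //; congr (_.[_]); apply: eq_bigr => k _.
    by rewrite ffunE mulfVK.
  apply/ffunP => k; rewrite ffunE.
  apply: (mulIf (uc_neq0 k)); rewrite mulfVK //.
  apply/eqP; rewrite -subr_eq0; apply/eqP.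
  move: k; apply: (muntz_bernstein_free mu_part a_gt0 lt_ab).
  apply: poly_eq_pos => t t_gt0.
  under eq_bigr do rewrite scalerBl.
  by rewrite sumrB hornerD hornerN -cE // -lin // -c'E // subrr horner0.
- move=> t t_gt0.
  have [D DE] := muntz_bernstein_span n.+1 mu_part a_gt0 lt_ab.
  have sum1 : 1 = \sum_k D ord0 k *: P k.
    by rewrite -DE /muntz_exponent subnn expr0.
  have D_eq := unit_coefP mu_part a_gt0 lt_ab (esym sum1).
  transitivity (1 : {poly R}).[t]; last by rewrite hornerC.
  rewrite sum1 horner_sum.
  by apply: eq_bigr => k _; rewrite B_eq // hornerZ D_eq.
Qed.

Theorem theorem5 (R : realType) (n : nat) (lam : n.-tuple nat) (a b : R)
    (hn : (1 <= n)%N) (hlam : is_partition lam) (ha : 0 < a) (hab : a < b)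
    (B : 'I_n.+1 -> R -> R) :
  chebyshev_bernstein_basis lam a b B <->
  (forall (k : 'I_n.+1) (t : R), 0 < t ->
     B k t =
       schur1 R lam n.+1 / schur1 R (behead lam) n
       * bernstein n k a b t
       * (schur (behead lam) (nseq (n - k) a ++ nseq k b)
          * t ^+ nth 0%N lam 0
          * schur lam (nseq (n - k) a ++ nseq k b ++ [:: a * b / t])
          / (schur lam (nseq (n.+1 - k) a ++ nseq k b)
             * schur lam (nseq (n - k) a ++ nseq k.+1 b)))).
Proof.
case: n lam B hn hlam => // n lam B _ mu_part.
have [to_coef of_coef] := chebyshev_bernstein_iff B mu_part ha hab.
split=> [/to_coef B_eq k t t_gt0|B_eq]; last apply: of_coef => k t t_gt0.
  by rewrite B_eq // horner_muntz_bernstein.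
by rewrite B_eq // horner_muntz_bernstein.
Qed.
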